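(* Let $\ell\ge 1$, $n\geq 1$, let $\lambda:R^+\to\mathbb{C}^\times$ be any primitive linear character, and let $X$ be the $\mathbb{C}\mathrm{U}$-module afforded by any Weil representation of $\mathrm{U}=\mathrm{U}(V,h)$ of type $\lambda$. Then $X$ has exactly $2(q^{\ell-1}+q^{\ell-2}+\cdots+1)$ irreducible constituents as a $\mathrm{U}$-module, all non-isomorphic to each other.
   Context: Rings. Let $\mathcal{O}$ be a local principal ideal domain that is not a field, with maximal ideal $\mathcal{O}s$ and finite residue field $F_q$ of odd characteristic. Let $\mathcal{R}=\mathcal{O}[X]/(X^2-s)=\mathcal{O}\oplus\mathcal{O}t$, $t^2=s$, with the involution fixing $\mathcal{O}$ elementwise and sending $t\mapsto -t$. Fix $\ell\ge 1$ and set $A=\mathcal{R}/\mathcal{R}t^{2\ell-1}$, $R=\mathcal{O}/\mathcal{O}s^{\ell}$. Let $\pi$ be the image of $t$ in $A$ and $p$ the image of $s$ in $R$. Then $R$ embeds in $A$, $A=R\oplus R\pi$, $\pi^2=p$, and $A$ has an induced involution $*$ fixing $R$ elementwise and sending $\pi\mapsto-\pi$. Forms. $V$ is a free $A$-module of rank $2n$, $n\ge 1$, and $h:V\times V\to A$ is a nondegenerate skew hermitian form: $h$ is $A$-linear in the second variable, $*$-linear in the first, $h(v,u)=-h(u,v)^*$, and $u\mapsto h(u,-)$ is an injective map $V\to\mathrm{Hom}_A(V,A)$. $\mathrm{U}=\mathrm{U}(V,h)$ is the group of all $g\in\mathrm{GL}_A(V)$ preserving $h$. Put $f(v,w)=\frac{h(v,w)+h(v,w)^*}{2}\in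 R$; this is a nondegenerate alternating $R$-bilinear form on $V$. $\mathrm{Sp}=\mathrm{Sp}(V,f)$ is the group of all $g\in\mathrm{GL}_R(V)$ preserving $f$; thus $\mathrm{U}\le\mathrm{Sp}$. Weil representations. A linear character $\lambda:R^+\to\mathbb{C}^\times$ is primitive if its kernel contains no nonzero ideal of $R$. The Heisenberg group is $H=R\times V$ with $(r,u)(s,v)=(r+s+f(u,v),u+v)$ and center $(R,0)$, identified with $R^+$. Up to isomorphism $H$ has a unique irreducible complex representation $S:H\to\mathrm{GL}(X)$ on which $(R,0)$ acts via $\lambda$ (Schrödinger representation of type $\lambda$); its dimension is $\sqrt{|V|}$. For a subgroup $G\le\mathrm{Sp}$, a Weil representation of $G$ of type $\lambda$ is any representation $W:G\to\mathrm{GL}(X)$ with $W(g)S(r,u)W(g)^{-1}=S(r,gu)$ for all $g\in G$, $(r,u)\in H$. (Such representations exist, and any two differ by a linear character of $G$.) All representations are finite dimensional over $\mathbb{C}$. *)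

(* Defs.v *)
From HB Require Import structures.
From mathcomp Require Import all_boot all_order all_fingroup all_algebra.
From mathcomp Require Import mxrepresentation character.
From mathcomp Require Import reals complex.

Set Implicit Arguments.
Unset Strict Implicit.
Unset Printing Implicit Defensive.
Import GRing.Theory.
Local Open Scope ring_scope.

Section Ideals.
Variable O : comNzRingType.
Implicit Types (I J M : O -> Prop) (a : O).

Definition is_ideal I : Prop :=
  [/\ I 0, (forall x y, I x -> I y -> I (x + y))
    & (forall a x, I x -> I (a * x))].

Definition multiples a : O -> Prop := fun x => exists b, x = b * a.

Definition all_ideals_principal : Prop :=
  forall I, is_ideal I -> exists a, forall x, I x <-> multiples a x.

Definition maximal_ideal I : Prop :=
  [/\ is_ideal I, ~ I 1
    & forall J, is_ideal J -> (forall x, I x -> J x) ->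
        J 1 \/ (forall x, J x -> I x)].

Definition local_with_maximal_ideal M : Prop :=
  maximal_ideal M /\ forall J, maximal_ideal J -> forall x, J x <-> M x.

End Ideals.

(* [phi] presents [Q] as the quotient of [P] by the ideal [I]. Stating quotients
   this way, up to isomorphism, lets the finite ones carry the library's finite
   ring structures. *)
Definition is_quotient (P Q : comNzRingType) (phi : {rmorphism P -> Q})
    (I : P -> Prop) : Prop :=
  (forall y, exists x, phi x = y) /\ (forall x, phi x = 0 <-> I x).

(* The order of the variables in [h]: [star]-linear in the first, linear in the
   second (the library's sesquilinear forms use the opposite order). *)
Definition skew_hermitian (A : comNzRingType) (star : A -> A)
    (V : lmodType A) (h : V -> V -> A) : Prop :=
  [/\ (forall u a v w, h u (a *: v + w) = a * h u v + h u w),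
      (forall a u w v, h (a *: u + w) v = star a * h u v + h w v)
    & (forall u v, h v u = - star (h u v))].

Definition form_nondegenerate (A V : Type) (h : V -> V -> A) : Prop :=
  forall u u', h u =1 h u' -> u = u'.

(* Matrices in [{'GL_m[A]}] have size [m.-1.+1]; for [m = 2n] with [n >= 1] this
   is [2n]. Column vectors make the action of [g] a left action. *)
Notation "''V_' n [ A ]" := 'cV[A]_((2 * n).-1.+1)
  (at level 8, n at level 2, format "''V_' n [ A ]").

Section UnitaryGroup.
Variables (A : finComUnitRingType) (n : nat) (h : 'V_n[A] -> 'V_n[A] -> A).

Definition unitary : {set {'GL_(2 * n)[A]}} :=
  [set g : {'GL_(2 * n)[A]} |
    [forall u, forall v, h (GLval g *m u) (GLval g *m v) == h u v]].

Fact unitary_group_set : group_set unitary.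
Proof.
apply/group_setP; split=> [|g1 g2].
  by rewrite inE; apply/forallP=> u; apply/forallP=> v; rewrite GL_1E !mul1mx.
rewrite !inE => /forallP h1 /forallP h2; apply/forallP=> u; apply/forallP=> v.
rewrite GL_MxE -!mulmxA.
have /forallP/(_ (GLval g2 *m v))/eqP -> := h1 (GLval g2 *m u).
exact: (forallP (h2 u)).
Qed.

Canonical unitary_group := Group unitary_group_set.

End UnitaryGroup.

Record biadditive (V R : zmodType) := Biadditive {
  biadditive_fun :> V -> V -> R;
  biadditiveDl : forall u u' v,
    biadditive_fun (u + u') v = biadditive_fun u v + biadditive_fun u' v;
  biadditiveDr : forall u v v',
    biadditive_fun u (v + v') = biadditive_fun u v + biadditive_fun u v' }.

(* The Heisenberg group on [R * V], with
   (r, u) (s, v) = (r + s + f (u, v), u + v). *)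
Record heisenberg (V R : finZmodType) (f : biadditive V R) :=
  Heis { heis_val : R * V }.

HB.instance Definition _ (V R : finZmodType) (f : biadditive V R) :=
  [isNew for @heis_val V R f].
HB.instance Definition _ (V R : finZmodType) (f : biadditive V R) :=
  [Finite of heisenberg f by <:].

Section HeisenbergGroup.
Variables (V R : finZmodType) (f : biadditive V R).
Local Notation H := (heisenberg f).

Definition heis_mul (x y : H) : H :=
  let: (r, u) := heis_val x in let: (s, v) := heis_val y in
  Heis f (r + s + f u v, u + v).

Definition heis_one : H := Heis f (0, 0).

Definition heis_inv (x : H) : H :=
  let: (r, u) := heis_val x in Heis f (f u u - r, - u).

Let f0l v : f 0 v = 0.
Proof. by apply: (addrI (f 0 v)); rewrite -biadditiveDl !addr0. Qed.

Let f0r u : f u 0 = 0.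
Proof. by apply: (addrI (f u 0)); rewrite -biadditiveDr !addr0. Qed.

Let fNl u v : f (- u) v = - f u v.
Proof. by apply: (addrI (f u v)); rewrite -biadditiveDl !subrr f0l. Qed.

Let fNr u v : f u (- v) = - f u v.
Proof. by apply: (addrI (f u v)); rewrite -biadditiveDr !subrr f0r. Qed.

Fact heis_mulA : associative heis_mul.
Proof.
move=> [[r u]] [[s v]] [[t w]]; rewrite /heis_mul /= biadditiveDl biadditiveDr.
congr (Heis _ (_, _)); last by rewrite addrA.
rewrite -!addrA; congr (_ + (_ + _)).
by rewrite [RHS]addrCA; congr (_ + _); rewrite [LHS]addrC -addrA.
Qed.

Fact heis_mul1l : left_id heis_one heis_mul.
Proof. by move=> [[r u]]; rewrite /heis_mul /= f0l !add0r addr0. Qed.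

Fact heis_mul1r : right_id heis_one heis_mul.
Proof. by move=> [[r u]]; rewrite /heis_mul /= f0r !addr0. Qed.

Fact heis_mulVl : left_inverse heis_one heis_inv heis_mul.
Proof.
by move=> [[r u]]; rewrite /heis_mul /= fNl subrK !subrr addNr.
Qed.

Fact heis_mulVr : right_inverse heis_one heis_inv heis_mul.
Proof.
by move=> [[r u]]; rewrite /heis_mul /= fNr addrCA !subrr addr0 subrr.
Qed.

HB.instance Definition _ :=
  isGroup.Build H heis_mulA heis_mul1l heis_mul1r heis_mulVl heis_mulVr.

End HeisenbergGroup.

Section WeilRepresentations.
Variables (R : finComNzRingType) (C : fieldType).

Definition linear_character (lambda : R -> C) : Prop :=
  lambda 0 = 1 /\ {morph lambda : x y / x + y >-> x * y}.

Definition primitive_character (lambda : R -> C) : Prop :=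
  forall I, is_ideal I -> (forall x, I x -> lambda x = 1) ->
    forall x, I x -> x = 0.

Definition schrodinger (V : finZmodType) (f : biadditive V R)
    (lambda : R -> C) (d : nat)
    (S : mx_representation C [set: heisenberg f] d) : Prop :=
  mx_irreducible S /\ forall r, S (Heis f (r, 0)) = (lambda r)%:M.

Definition weil (A : finComUnitRingType) (n : nat) (f : biadditive 'V_n[A] R)
    (G : {group {'GL_(2 * n)[A]}}) (lambda : R -> C) (d : nat)
    (W : mx_representation C G d) : Prop :=
  exists2 S : mx_representation C [set: heisenberg f] d,
    schrodinger lambda S
  & forall g, g \in G -> forall r u,
      W g *m S (Heis f (r, u)) *m invmx (W g) = S (Heis f (r, GLval g *m u)).

End WeilRepresentations.

(* [rG] is the direct sum of [N] irreducible representations, pairwise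
   nonisomorphic; [N] is then the number of irreducible constituents. *)
Definition multiplicity_free_with (C : fieldType) (gT : finGroupType)
    (G : {group gT}) (d : nat) (rG : mx_representation C G d) (N : nat) : Prop :=
  exists rho : 'I_N -> representation C G,
    [/\ (forall i, mx_irreducible (rho i)),
        (forall i j, i != j -> ~ mx_rsim (rho i) (rho j))
      & mx_rsim rG (\big[@dadd_grepr C gT G/@grepr0 C gT G]_(i < N) rho i)].

(* Main.v *)
Require Import Defs.
From HB Require Import structures.
From mathcomp Require Import all_boot all_order all_fingroup all_algebra.
From mathcomp Require Import pgroup mxrepresentation character.
From mathcomp Require Import reals complex ring zify.

Set Implicit Arguments.
Unset Strict Implicit.
Unset Printing Implicit Defensive.
Import GRing.Theory.
Local Open Scope ring_scope.

(* The operators T(v) = S(0, v), for v in V, form a basis of End(X), with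
   T(u) T(v) = lambda(f(u, v)) T(u + v), and U permutes them by conjugation.
   Hence the sums of T over the U-orbits on V form a basis of End_U(X), and it
   is enough to count the orbits and to show that the orbit sums commute.

   Write pi for the image of t in A and L = 2l - 1, so that pi^L = 0. Call w in
   V primitive if h(w, -) takes a unit value; every nonzero vector is pi^i w
   with w primitive and i < L. By means of unitary transvections U is
   transitive on the primitive vectors of given norm h(w, w), and a primitive
   vector can be moved inside its class modulo the annihilator of pi^i to adjust
   its norm. So the orbit of pi^i w is determined by i and by pi^i h(w, w),
   which ranges over pi^(i+1) R; with the orbit {0}, this makes
   2 (1 + q + ... + q^(l-1)) orbits.

   For the commutation, fix w = pi^i w0 with w0 primitive, and complete w0 to a
   pair (w0, z) with h(w0, z) = 1 and h(z, z) = 0. The additive bijection of V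
   that fixes the orthogonal complement of that pair and sends a w0 + b z to
   (-1)^i (a^* w0 - b^* z) fixes w, preserves the orbits, and changes the sign
   of f(-, w). Hence it exchanges the coefficients of T(w) in the products of two
   orbit sums in the two orders. *)

(** * Multiplicity-free representations *)

Section Commutant.
Variables (F : numClosedFieldType) (gT : finGroupType) (G : {group gT}).
Variables (d : nat) (rG : mx_representation F G d).

Section SimpleSum.
Variables (I : finType) (U : I -> 'M[F]_d).
Hypothesis simU : forall i, mxsimple rG (U i).
Hypothesis sumU : (\sum_i U i :=: 1%:M)%MS.
Hypothesis dxU : mxdirect (\sum_i U i)%MS.
Hypothesis comm_cent : forall M M', centgmx rG M -> centgmx rG M' ->
  M *m M' = M' *m M.

Let modU i : mxmodule rG (U i). Proof. by case: (simU i). Qed.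

Definition summand_proj i : 'M[F]_d :=
  proj_mx (U i) (\sum_(j | j != i) U j)%MS.

Let tiU i : (U i :&: \sum_(j | j != i) U j)%MS = 0.
Proof. by move/mxdirect_sumsP: dxU => ->. Qed.

Lemma mul_summand_proj i : U i *m summand_proj i = U i.
Proof. exact: proj_mx_id. Qed.

Lemma mul_summand_proj0 i j : j != i -> U j *m summand_proj i = 0.
Proof. by move=> ji; apply: proj_mx_0; rewrite ?tiU // (sumsmx_sup j). Qed.

Lemma eq_on_summands (M M' : 'M[F]_d) :
  (forall i, U i *m M = U i *m M') -> M = M'.
Proof.
move=> eqM; have /sub_sumsmxP[u def1]: (1%:M <= \sum_i U i)%MS by rewrite sumU.
rewrite -[M]mul1mx -[M']mul1mx def1 !mulmx_suml.
by apply: eq_bigr => i _; rewrite -!mulmxA eqM.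
Qed.

Lemma centgmx_summand_proj i : centgmx rG (summand_proj i).
Proof.
apply/centgmxP => x Gx; apply: eq_on_summands => j.
have modUx k : (U k *m rG x <= U k)%MS by apply: (mxmoduleP (modU k)).
have [-> | ji] := eqVneq j i.
  rewrite [LHS]mulmxA mul_summand_proj mulmxA.
  by rewrite /summand_proj proj_mx_id ?tiU.
rewrite [LHS]mulmxA mul_summand_proj0 // mul0mx mulmxA.
have [u ->] := submxP (modUx j).
by rewrite -mulmxA mul_summand_proj0 // mulmx0.
Qed.

(** The projection onto [U i] lies in the commutant, which is commutative; so [M] commutes with it
    and preserves its image. *)
Lemma cent_stable_summand M i : centgmx rG M -> (U i *m M <= U i)%MS.
Proof.
move=> cM; rewrite -{1}(mul_summand_proj i) -mulmxA.
by rewrite (comm_cent (centgmx_summand_proj i) cM) mulmxA proj_mx_sub.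
Qed.

Lemma cent_scalar_summand M i : centgmx rG M -> exists a, U i *m M = a *: U i.
Proof.
move=> cM; have irrU := (submod_mx_irr (modU i)).2 (simU i).
have absU := group_closure_closed_field irrU.
(* The rows of [B] form a basis of [U i]. In this basis [M1] below is the matrix of [M] restricted
   to [U i], and Schur's lemma makes it scalar. *)
pose B : 'M_(\rank (U i), d) := val_submod 1%:M.
have BE W : val_submod W = W *m B := val_submodE W.
have Bx x : x \in G -> B *m rG x = submod_repr (modU i) x *m B.
  by move=> Gx; rewrite -BE -[submod_repr _ x]mul1mx val_submodJ.
have [M1 defM1] : exists M1, B *m M = M1 *m B.
  have sBM : (B *m M <= U i)%MS.
    apply: submx_trans (cent_stable_summand i cM).
    by rewrite submxMr // val_submod1.
  by exists (in_submod (U i) (B *m M)); rewrite -BE in_submodK.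
have cM1 : centgmx (submod_repr (modU i)) M1.
  apply/centgmxP => x Gx; apply: val_submod_inj; rewrite !BE.
  move: (submod_repr _ x) (Bx x Gx) => Sx BSx.
  rewrite -mulmxA -BSx mulmxA -defM1 -mulmxA (centgmxP cM) // mulmxA BSx.
  by rewrite -[LHS]mulmxA -[RHS]mulmxA defM1.
have /is_scalar_mxP[a M1a] := mx_abs_irr_cent_scalar absU cM1.
exists a; have /submxP[u ->] : (U i <= B)%MS by rewrite val_submod1.
by rewrite -mulmxA defM1 M1a mul_scalar_mx -scalemxAr.
Qed.

Lemma cent_sum_summand_proj M : centgmx rG M ->
  exists a : I -> F, M = \sum_i a i *: summand_proj i.
Proof.
move=> cM; have /fin_all_exists[a Ma] i := cent_scalar_summand i cM.
exists a; apply: eq_on_summands => j; rewrite Ma mulmx_sumr (bigD1 j) //=.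
rewrite -scalemxAr mul_summand_proj big1 ?addr0 // => i ij.
by rewrite -scalemxAr mul_summand_proj0 ?scaler0 // eq_sym.
Qed.

Lemma summand_proj_free (c : I -> F) :
  \sum_i c i *: summand_proj i = 0 -> forall i, c i = 0.
Proof.
move=> c0 i; have : U i *m (\sum_j c j *: summand_proj j) = c i *: U i.
  rewrite mulmx_sumr (bigD1 i) //= -scalemxAr mul_summand_proj big1 ?addr0 //.
  by move=> j ji; rewrite -scalemxAr mul_summand_proj0 ?scaler0 // eq_sym.
rewrite c0 mulmx0 => /esym/eqP; rewrite scaler_eq0.
by case: (simU i) => _ /negPf-> _; rewrite orbF => /eqP.
Qed.

(** An isomorphism [f] onto [U j], preceded by the projection onto [U i], would lie in the commutant
    and carry [U i] onto [U j], against the stability of [U i]. *)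
Lemma summands_not_iso i j : i != j -> ~ mx_iso rG (U i) (U j).
Proof.
move=> ij [f injf homf defUj].
have cPf : centgmx rG (summand_proj i *m f).
  apply/centgmxP => x Gx.
  have sPf : (summand_proj i <= dom_hom_mx rG f)%MS.
    by apply: submx_trans homf; rewrite -[summand_proj i]mul1mx proj_mx_sub.
  rewrite -(hom_mxP sPf) // (centgmxP (centgmx_summand_proj i)) //.
  exact/esym/mulmxA.
have := cent_stable_summand i cPf.
rewrite mulmxA mul_summand_proj defUj => sUji.
case: (simU j) => _ /negP[]; rewrite -submx0 -(tiU i) sub_capmx sUji.
by rewrite (sumsmx_sup j) // eq_sym.
Qed.

(** Elements of the commutant are scalar on each summand, so the projections form a basis of the
    commutant, as [X] does. *)
Lemma card_summands (X : seq 'M[F]_d) : free X ->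
  (forall M, (M \in <<X>>%VS) = centgmx rG M) -> #|I| = size X.
Proof.
move=> freeX spanX; pose P := [tuple of codom summand_proj].
have PE (c : 'I_#|I| -> F) : \sum_i c i *: P`_i
    = \sum_i c (enum_rank i) *: summand_proj i.
  rewrite [RHS](reindex (@enum_val _ I)) /=; last exact/onW_bij/enum_val_bij.
  apply: eq_bigr => i _; rewrite enum_valK; congr (_ *: _).
  exact: nth_codom.
have freeP : free P.
  apply/freeP => c; rewrite PE => c0 i.
  by rewrite -(enum_valK i) (summand_proj_free c0 (enum_val i)).
suffices: <<P>>%VS = <<X>>%VS.
  move=> eqPX; rewrite -(eqnP freeX) -eqPX (eqnP freeP).
  exact/esym/size_tuple.
apply/vspaceP => M; rewrite spanX; apply/idP/idP => [/coord_span-> | cM].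
  rewrite PE; apply/centgmxP => x Gx; rewrite mulmx_suml mulmx_sumr.
  apply: eq_bigr => i _; rewrite -scalemxAl -scalemxAr.
  by rewrite (centgmxP (centgmx_summand_proj i)).
have [a ->] := cent_sum_summand_proj cM.
by apply: memv_suml => i _; apply/memvZ/memv_span/codom_f.
Qed.

End SimpleSum.

Lemma multiplicity_free_commutant (X : seq 'M[F]_d) : free X ->
    (forall M, (M \in <<X>>%VS) = centgmx rG M) ->
    {in X &, forall M M', M *m M' = M' *m M} ->
  multiplicity_free_with rG (size X).
Proof.
move=> freeX spanX commX.
have comm_cent M M' : centgmx rG M -> centgmx rG M' -> M *m M' = M' *m M.
  rewrite -!spanX => /(@coord_span _ _ _ (in_tuple X))->.
  move=> /(@coord_span _ _ _ (in_tuple X))->.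
  rewrite !mulmx_suml; under eq_bigr do rewrite mulmx_sumr.
  rewrite exchange_big; apply: eq_bigr => i _.
  rewrite mulmx_sumr; apply: eq_bigr => j _.
  rewrite -!scalemxAl -!scalemxAr !scalerA mulrC; congr (_ *: _).
  by apply: commX; apply: mem_nth.
have charG : ([pchar F]^'.-group G)%g.
  by rewrite /pgroup pcharf'_nat Num.Theory.pnatr_eq0 -lt0n cardG_gt0.
have [I U /= simU sumU dxU] :=
  dec_mx_reducible_semisimple (mxmodule1 rG) (mx_Maschke_pchar rG charG).
rewrite -(card_summands simU sumU dxU comm_cent freeX spanX).
have modU i : mxmodule rG (U i) by case: (simU i).
exists (fun i : 'I_#|I| => Representation (submod_repr (modU (enum_val i)))).
split=> [i|i j ij /mx_rsim_iso|].
- exact/submod_mx_irr.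
- apply: (summands_not_iso simU sumU dxU comm_cent).
  by rewrite (inj_eq enum_val_inj).
apply: mx_rsim_trans (mx_rsim_sym (rsim_submod1 (mxmodule1 rG) _)) _ => //.
pose U' (i : 'I_#|I|) := U (enum_val i).
have bijI : {on predT, bijective (enum_val : 'I_#|I| -> I)}.
  exact/onW_bij/enum_val_bij.
apply: (mx_rsim_dsum (U := U') (modU := fun i => modU (enum_val i))) => [||i].
- by move: sumU; rewrite (reindex _ bijI).
- by move: dxU; rewrite !mxdirectE /= !(reindex _ bijI).
exact: mx_rsim_refl.
Qed.

End Commutant.

(** * Orbit sums of a permuted basis of operators *)

Section OrbitSums.
Variables (F : numClosedFieldType) (gT : finGroupType) (G : {group gT}).
Variables (d : nat) (rG : mx_representation F G d).
Variables (V : finZmodType) (K : finType) (cl : V -> K) (to : gT -> V -> V).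
Variables (T : V -> 'M[F]_d) (psi : V -> V -> F).
Hypothesis T_span : forall M, exists c : V -> F, M = \sum_v c v *: T v.
Hypothesis T_free : forall c : V -> F,
  \sum_v c v *: T v = 0 -> forall v, c v = 0.
Hypothesis T_mul : forall u v, T u *m T v = psi u v *: T (u + v).
Hypothesis to_inj : forall g, g \in G -> injective (to g).
Hypothesis T_to : forall g v, g \in G -> rG g *m T v = T (to g v) *m rG g.
Hypothesis cl_orbit : forall u v,
  cl u = cl v <-> exists2 g, g \in G & v = to g u.

Definition class_sum k : 'M[F]_d := \sum_(v | cl v == k) T v.

Definition class_sums : seq 'M[F]_d := [seq class_sum k | k in cl @: setT].

Let clK k : k \in cl @: setT -> exists v, k = cl v.
Proof. by case/imsetP => v _ ->; exists v. Qed.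

Lemma class_functionE (c : K -> F) :
  \sum_v c (cl v) *: T v = \sum_(k in cl @: setT) c k *: class_sum k.
Proof.
rewrite (partition_big cl (mem (cl @: setT))) /= => [|v _]; last exact: imset_f.
apply: eq_bigr => k _; rewrite scaler_sumr.
by apply: eq_bigr => v /eqP->.
Qed.

Let sum_class_sums (c : K -> F) :
  \sum_(k in cl @: setT) c k *: class_sum k
    = \sum_(i < #|cl @: setT|) c (enum_val i) *: class_sums`_i.
Proof.
rewrite big_enum_val; apply: eq_bigr => i _; congr (_ *: _).
rewrite (nth_map (enum_val i)) -?cardE // /enum_val.
by congr class_sum; apply: set_nth_default; rewrite -cardE.
Qed.

Lemma class_sums_free : free class_sums.
Proof.
have sz : size class_sums = #|cl @: setT| by rewrite size_map cardE.
rewrite (_ : class_sums = Tuple (introT eqP sz)) //; apply/freeP => c c0 i.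
(* [c'] carries the coefficients from indices to labels; the default 0 is taken only at labels that
   no vector has. *)
pose c' k := oapp c 0 [pick j | enum_val j == k].
have c'E j : c' (enum_val j) = c j.
  rewrite /c'; case: pickP => [j' /eqP/enum_val_inj-> //|/(_ j)].
  by rewrite eqxx.
have [v defv] : exists v, enum_val i = cl v by apply: clK; apply: enum_valP.
rewrite -c'E defv; apply: (T_free (c := c' \o cl)).
rewrite /= (class_functionE c') sum_class_sums -[RHS]c0.
by apply: eq_bigr => j _; rewrite c'E.
Qed.

Lemma T_inj_coef (c c' : V -> F) :
  \sum_v c v *: T v = \sum_v c' v *: T v -> c =1 c'.
Proof.
move/eqP; rewrite -subr_eq0 -sumrB => /eqP eq0 v; apply/eqP.
rewrite -subr_eq0; apply/eqP; move: v; apply: T_free; rewrite -[RHS]eq0.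
by apply: eq_bigr => v _; rewrite scalerBl.
Qed.

Lemma span_class_sums M : (M \in <<class_sums>>%VS) = centgmx rG M.
Proof.
apply/idP/idP => [|cM].
  move=> /(@coord_span _ _ _ (in_tuple class_sums))->.
  apply/centgmxP => g Gg; rewrite mulmx_suml mulmx_sumr.
  apply: eq_bigr => i _; rewrite -scalemxAl -scalemxAr; congr (_ *: _).
  have /mapP[k _ ->] : class_sums`_i \in class_sums by apply: mem_nth.
  rewrite mulmx_suml mulmx_sumr [RHS](eq_bigr _ (fun v _ => T_to v Gg)).
  rewrite [LHS](reindex_inj (to_inj Gg)) /=; apply: eq_bigl => v.
  by congr (_ == k); apply/esym/cl_orbit; exists g.
have [c defM] := T_span M.
(* Conjugation by [rG g] permutes the [T v]; comparing coefficients in this basis shows that those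
   of [M] are constant on orbits. *)
have c_to g v : g \in G -> c (to g v) = c v.
  move=> Gg; have [f fK Kf] : bijective (to g) by apply/injF_bij/to_inj.
  have := centgmxP cM g Gg; rewrite defM mulmx_suml mulmx_sumr.
  under [RHS]eq_bigr do rewrite -scalemxAr T_to // scalemxAl.
  rewrite -!mulmx_suml => /(can_inj (mulmxK (repr_mx_unit rG Gg))).
  rewrite [RHS](reindex_inj (can_inj Kf)) /=.
  under [RHS]eq_bigr do rewrite Kf.
  by move/T_inj_coef => ->; rewrite fK.
have [c' c'E] : exists c' : K -> F, forall v, c v = c' (cl v).
  exists (fun k => oapp c 0 [pick v | cl v == k]) => v.
  case: pickP => [v' /eqP/cl_orbit[g Gg ->]|/(_ v)]; first by rewrite c_to.
  by rewrite eqxx.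
rewrite defM; under eq_bigr do rewrite c'E.
rewrite class_functionE; apply: memv_suml => k Kk.
by apply/memvZ/memv_span/map_f; rewrite mem_enum.
Qed.

Hypothesis twist : forall w, exists2 sigma : V -> V, injective sigma &
  forall u, [/\ cl (sigma u) = cl u, cl (w - sigma u) = cl (w - u)
              & psi (sigma u) (w - sigma u) = psi (w - u) u].

Let class_sum_mul k k' : class_sum k *m class_sum k' =
  \sum_w (\sum_(u | (cl u == k) && (cl (w - u) == k')) psi u (w - u)) *: T w.
Proof.
rewrite mulmx_suml; under eq_bigr do rewrite mulmx_sumr.
under eq_bigr => u _ do rewrite (reindex_inj (addIr (- u))) /=.
rewrite (exchange_big_dep predT) //=; apply: eq_bigr => w _.
rewrite scaler_suml; apply: eq_bigr => u _.
by rewrite T_mul [u + _]addrC subrK.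
Qed.

(** In the coefficient of [T w], substituting [sigma u] on the left and [w - u] on the right leads
    to the same sum. *)
Lemma class_sum_comm k k' :
  class_sum k *m class_sum k' = class_sum k' *m class_sum k.
Proof.
rewrite !class_sum_mul; apply: eq_bigr => w _; congr (_ *: _).
have [sigma sigma_inj sigmaP] := twist w.
rewrite (reindex_inj sigma_inj) /= [RHS](reindex_inj (can_inj (subKr w))) /=.
apply: eq_big => [u | u _]; have [clu clwu psiu] := sigmaP u.
  by rewrite clu clwu subKr andbC.
by rewrite psiu subKr.
Qed.

Lemma multiplicity_free_orbits : multiplicity_free_with rG #|cl @: setT|.
Proof.
rewrite [N in multiplicity_free_with _ N](_ : _ = size class_sums).
  apply: multiplicity_free_commutant => [||M M'].
  - exact: class_sums_free.
  - exact: span_class_sums.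
  by case/mapP => k _ -> /mapP[k' _ ->]; apply: class_sum_comm.
by rewrite size_map cardE.
Qed.

End OrbitSums.

(** * Schrodinger representations *)

Section Schrodinger.
Variables (R : finComNzRingType) (V : finZmodType) (f : biadditive V R).
Variables (F : numClosedFieldType) (lambda : R -> F) (d : nat).
Variable S : mx_representation F [set: heisenberg f] d.
Hypothesis lambda_character : linear_character lambda.
Hypothesis S_schrodinger : schrodinger lambda S.

Definition heis_op v : 'M[F]_d := S (Heis f (0, v)).

Let heisM r u r' v : (Heis f (r, u) * Heis f (r', v))%g
  = Heis f (r + r' + f u v, u + v).
Proof. by []. Qed.

Let f0v v : f 0 v = 0.
Proof. by apply: (addrI (f 0 v)); rewrite -biadditiveDl !addr0. Qed.

Let lambdaD : {morph lambda : x y / x + y >-> x * y}.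
Proof. by case: lambda_character. Qed.

Let lambda_neq0 x : lambda x != 0.
Proof.
apply/eqP => lx0; case: lambda_character => /eqP + _.
by rewrite -(subrr x) lambdaD lx0 mul0r eq_sym oner_eq0.
Qed.

Lemma heis_opE r v : S (Heis f (r, v)) = lambda r *: heis_op v.
Proof.
have -> : Heis f (r, v) = (Heis f (r, 0) * Heis f (0, v))%g.
  by rewrite heisM f0v !addr0 add0r.
by rewrite repr_mxM ?inE // S_schrodinger.2 mul_scalar_mx.
Qed.

Lemma heis_opM u v : heis_op u *m heis_op v = lambda (f u v) *: heis_op (u + v).
Proof. by rewrite -repr_mxM ?inE // heisM !add0r heis_opE. Qed.

(** The operators of an absolutely irreducible representation span all matrices, and central
    elements contribute only the scalars [lambda r]. *)
Lemma heis_op_span M : exists c : V -> F, M = \sum_v c v *: heis_op v.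
Proof.
have := group_closure_closed_field S_schrodinger.1.
move=> /mx_abs_irrP[_ [a aE]].
exists (fun v => \sum_r a (Heis f (r, v)) M * lambda r).
rewrite {1}[M]aE (reindex (fun x : V * R => Heis f (x.2, x.1))) /=; last first.
  exists (fun x => let: (r, v) := heis_val x in (v, r)); first by case.
  by do 2!case.
under eq_bigl do rewrite inE.
rewrite -(pair_bigA _ (fun v r => a (Heis f (r, v)) M *: S (Heis f (r, v)))) /=.
apply: eq_bigr => v _; rewrite scaler_suml; apply: eq_bigr => r _.
by rewrite heis_opE scalerA.
Qed.

Hypothesis f_separates :
  forall v, v != 0 -> exists u, lambda (f u v) != lambda (f v u).

(** Conjugation by a suitable [heis_op u] multiplies [heis_op v] by a scalar other than 1, while it
    preserves the trace. *)
Lemma heis_op_trace v : v != 0 -> \tr (heis_op v) = 0.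
Proof.
move=> /f_separates[u neq]; apply/eqP; apply: contraR neq => trv.
have Uu : heis_op u \in unitmx by apply: repr_mx_unit; rewrite inE.
have : lambda (f v u) *: (heis_op u *m heis_op v)
    = lambda (f u v) *: (heis_op v *m heis_op u).
  by rewrite !heis_opM !scalerA mulrC [v + u]addrC.
move/(congr1 (fun M => \tr (invmx (heis_op u) *m M))).
rewrite -!scalemxAr !mxtraceZ mulKmx // mxtrace_mulC mulmxK // => /eqP.
by rewrite (inj_eq (mulIf trv)) eq_sym.
Qed.

Lemma heis_op_free (c : V -> F) :
  \sum_v c v *: heis_op v = 0 -> forall v, c v = 0.
Proof.
move=> c0 w; have d_neq0 : d%:R != 0 :> F.
  by rewrite Num.Theory.pnatr_eq0 -lt0n; have /mx_irrP[] := S_schrodinger.1.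
(* Multiplying by [heis_op (- w)] moves the term of [w] to the identity, the only one with nonzero
   trace; this isolates [c w]. *)
have : \tr ((\sum_v c v *: heis_op v) *m heis_op (- w)) = 0.
  by rewrite c0 mul0mx mxtrace0.
rewrite mulmx_suml raddf_sum (bigD1 w) //= big1 ?addr0 => [|v vw]; last first.
  by rewrite -scalemxAl heis_opM !mxtraceZ heis_op_trace ?mulr0 // subr_eq0.
rewrite -scalemxAl heis_opM subrr [heis_op 0](repr_mx1 S) scalerA mxtraceZ.
rewrite mxtrace1 => /eqP.
by rewrite !mulf_eq0 (negPf d_neq0) (negPf (lambda_neq0 _)) !orbF => /eqP.
Qed.

End Schrodinger.

(** * Chain rings with involution *)

Section ChainRing.
Variables (A : finComUnitRingType) (star : {rmorphism A -> A}).
Variables (pi : A) (L : nat).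
Hypothesis starK : involutive star.
Hypothesis star_pi : star pi = - pi.
Hypothesis two_unit : (2%:R : A) \is a GRing.unit.
Hypothesis nonunit_pi : forall a : A,
  a \isn't a GRing.unit -> exists b, a = pi * b.
Hypothesis star_mod_pi : forall a, exists b, a - star a = pi * b.
Hypothesis piL : pi ^+ L = 0.
Hypothesis piL1 : pi ^+ L.-1 != 0.

Lemma pi_nonunit b : pi * b \isn't a GRing.unit.
Proof.
rewrite unitrM negb_and; apply/orP; left; apply/negP => /(unitrX L).
by rewrite piL unitr0.
Qed.

Lemma unitB_pi a b : a \is a GRing.unit -> a - pi * b \is a GRing.unit.
Proof.
move=> Ua; apply/negPn/negP => /nonunit_pi[c eqc].
have := pi_nonunit (c + b); rewrite mulrDr -eqc subrK.
by rewrite Ua.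
Qed.

Lemma unitD_pi a b : a \is a GRing.unit -> a + pi * b \is a GRing.unit.
Proof. by move/(unitB_pi (- b)); rewrite mulrN opprK. Qed.

Lemma pi_exp_eq0 n a : pi ^+ n * a = 0 -> (n < L)%N -> exists b, a = pi * b.
Proof.
move=> eq0 ltnL; apply: nonunit_pi; apply/negP => Ua.
case/eqP: piL1; rewrite -(mulrK Ua (pi ^+ L.-1)) -(subnK (_ : n <= L.-1)%N).
  by rewrite exprD -!mulrA [_ * (a / a)]mulrA eq0 mul0r mulr0.
by rewrite -ltnS prednK // (leq_ltn_trans _ ltnL).
Qed.

Let half : A := 2%:R^-1.

Let star_half : star half = half.
Proof. by rewrite rmorphV // rmorph_nat. Qed.

Let halfD a : half * (a + a) = a.
Proof. by rewrite -mulr2n -mulr_natl mulKr. Qed.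

(** Here [s] is half of [s - star s], hence a multiple of [pi]; averaging the cofactor with its
    conjugate makes it fixed. *)
Lemma skew_pi s : star s = - s -> exists2 r, star r = r & s = pi * r.
Proof.
move=> ss; have [b eqb] := star_mod_pi s.
have sE : s = pi * (half * b).
  by rewrite -[LHS]halfD -{2}[s]opprK -ss eqb; ring.
have sE' : s = pi * (half * star b).
  by rewrite -[LHS]opprK -ss {1}sE !rmorphM star_half star_pi; ring.
exists (half * (half * b + half * star b)).
  by rewrite !(rmorphM, rmorphD) star_half starK; ring.
by rewrite -[LHS]halfD {1}sE sE'; ring.
Qed.

(** If [r = pi * b] is fixed, then also [r = - pi * star b]. The mean of the two involves
    [b - star b], which supplies the second factor [pi]. *)
Lemma fixed_nonunit r :
  star r = r -> r \isn't a GRing.unit ->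
  exists2 r', star r' = r' & r = pi ^+ 2 * r'.
Proof.
move=> fr /nonunit_pi[b rE]; have [c bc] := star_mod_pi b.
have rE' : r = - pi * star b by rewrite -fr rE rmorphM star_pi.
have rE2 : r = pi ^+ 2 * (half * c).
  rewrite -[LHS]halfD {1}rE rE' expr2 -mulrA.
  transitivity (half * pi * (b - star b)).
    by ring.
  by rewrite bc; ring.
exists (half * (half * c + half * star c)).
  by rewrite !(rmorphM, rmorphD) star_half starK; ring.
have rE3 : r = pi ^+ 2 * (half * star c).
  by rewrite -fr rE2 !(rmorphM, rmorphXn) star_half star_pi; ring.
by rewrite -[LHS]halfD {1}rE2 rE3; ring.
Qed.

(* Since [pi k] is a nonunit, [y |-> 2 y - pi k y ^ 2] is injective, hence
   bijective as [A] is finite; by uniqueness the solution is fixed by [star]. *)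
Lemma fixed_quadratic_solution k e : star (pi * k) = pi * k -> star e = e ->
  exists2 y, star y = y & y + y - pi * k * (y * y) = e.
Proof.
move=> fk fe; pose phi y := y + y - pi * k * (y * y).
have phi_inj : injective phi.
  move=> y y' eqphi; apply/eqP; rewrite -subr_eq0; apply/eqP.
  apply: (mulIr (unitB_pi (k * (y + y')) two_unit)); rewrite mul0r.
  transitivity (phi y - phi y'); first by rewrite /phi; ring.
  by rewrite eqphi subrr.
have [g gK Kg] := injF_bij phi_inj.
exists (g e); last exact: Kg.
apply: phi_inj; rewrite Kg -[RHS]fe -[in RHS](Kg e) /phi.
by rewrite rmorphB rmorphD rmorphM fk rmorphM.
Qed.

(** * Cardinality of the multiples of [pi ^+ j] by fixed elements *)

Section FixedImages.
Variables (k : finType) (lift : k -> A).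
Hypothesis star_lift : forall c, star (lift c) = lift c.
Hypothesis lift_surj : forall r, star r = r -> exists c b, r = lift c + pi * b.
Hypothesis lift_inj : forall c c', c != c' -> lift c - lift c' \is a GRing.unit.

Definition pi_fixed j : {set A} :=
  [set pi ^+ j * r | r in [pred r | star r == r]].

Lemma pi_fixedP j a :
  reflect (exists2 r, star r = r & a = pi ^+ j * r) (a \in pi_fixed j).
Proof.
apply: (iffP imsetP) => -[r].
  by rewrite inE => /eqP fr ->; exists r.
by move=> fr ->; exists r; rewrite // inE fr.
Qed.

Lemma card_pi_fixed_ge j : (L <= j)%N -> #|pi_fixed j| = 1%N.
Proof.
move=> leLj; apply/eqP/cards1P; exists 0; apply/setP => a; rewrite inE.
have pij : pi ^+ j = 0 by rewrite -(subnK leLj) exprD piL mulr0.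
apply/pi_fixedP/eqP => [[r _ ->] | ->]; first by rewrite pij mul0r.
by exists 0; rewrite ?rmorph0 ?mulr0.
Qed.

(** A fixed [r] has a leading digit [lift c], and the remainder is a fixed nonunit, hence [pi ^+ 2]
    times a fixed element. The digit is unique because distinct lifts differ by a unit. *)
Lemma card_pi_fixedSS j : (j < L)%N ->
  #|pi_fixed j| = (#|k| * #|pi_fixed j.+2|)%N.
Proof.
move=> ltjL; have -> : pi_fixed j =
    [set pi ^+ j * lift p.1 + p.2 | p in setX [set: k] (pi_fixed j.+2)].
  apply/setP => a; apply/pi_fixedP/imsetP => [[r fr ->] | [[c x] /=]].
    have [c [b rE]] := lift_surj fr.
    have [||r' fr' eqr'] := @fixed_nonunit (r - lift c).
    - by rewrite rmorphB /= fr star_lift.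
    - by rewrite rE addrC addKr pi_nonunit.
    exists (c, pi ^+ j.+2 * r'); rewrite ?inE /=.
      by apply/pi_fixedP; exists r'.
    by rewrite -[r in LHS](subrK (lift c)) eqr' -[j.+2]addn2 exprD; ring.
  rewrite !inE /= => /pi_fixedP[r fr ->] ->.
  exists (lift c + pi ^+ 2 * r); last by rewrite -[j.+2]addn2 exprD; ring.
  by rewrite rmorphD rmorphM rmorphXn fr star_lift star_pi; ring.
rewrite card_in_imset ?cardsX ?cardsT // => -[c x] [c' x'].
rewrite !inE /= => /pi_fixedP[r fr ->] /pi_fixedP[r' fr' ->] eqx.
have [eqc | /lift_inj Ucc'] := eqVneq c c'.
  by congr (_, _) => //; move: eqx; rewrite eqc => /addrI.
have [||b eqb] := @pi_exp_eq0 j (lift c - lift c' + pi * (pi * (r - r'))) => //.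
  transitivity (pi ^+ j * lift c + pi ^+ j.+2 * r
      - (pi ^+ j * lift c' + pi ^+ j.+2 * r')).
    by rewrite -[j.+2]addn2 exprD; ring.
  by rewrite eqx subrr.
by have := unitD_pi (pi * (r - r')) Ucc'; rewrite eqb (negPf (pi_nonunit b)).
Qed.

(** Counting down from [L.+1] gives an induction by steps of two, each contributing one digit;
    [m = 0] and [m = 1] are the zero cases [j >= L]. *)
Lemma card_pi_fixed m :
  (m <= L.+1)%N -> #|pi_fixed (L.+1 - m)| = (#|k| ^ m./2)%N.
Proof.
elim/ltn_ind: m => -[|[|m]] IHm lem; rewrite ?subSS.
- by rewrite card_pi_fixed_ge // subn0.
- by rewrite card_pi_fixed_ge // subn0.
have lemL : (m < L)%N by rewrite -ltnS.
have jE : (L - m.+1).+2 = (L.+1 - m)%N.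
  by rewrite subnSK // subSn // ltnW.
rewrite card_pi_fixedSS ?jE; last by rewrite ltn_subrL (leq_ltn_trans _ lemL).
by rewrite IHm ?expnS // ltnW // ltnW.
Qed.

Lemma sum_card_pi_fixed l : L.+1 = (2 * l)%N ->
  ((\sum_(i < L) #|pi_fixed i.+1|).+1)%N = (2 * \sum_(i < l) #|k| ^ i)%N.
Proof.
(* The added one becomes the term [i = L], where the set is [{0}]; the [2 * l] terms then pair off
   into equal powers. *)
move=> LS; transitivity (\sum_(i < L.+1) #|pi_fixed i.+1|)%N.
  by rewrite big_ord_recr /= card_pi_fixed_ge // addn1.
rewrite (reindex_inj rev_ord_inj) /=.
transitivity (\sum_(i < L.+1) #|k| ^ i./2)%N.
  apply: eq_bigr => i _; have leiL : (i <= L)%N by rewrite -ltnS.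
  by rewrite subSS -subSn // card_pi_fixed // leqW.
rewrite {}LS mul2n; elim: l => [|l IHl]; first by rewrite !big_ord0.
rewrite doubleS !big_ord_recr /= IHl uphalf_double doubleK mulnDr.
by rewrite -addnA addnn [(2 * _ ^ _)%N]mul2n.
Qed.

End FixedImages.

(** * Orbits of the unitary group *)

Section UnitaryOrbits.
Variables (n : nat) (h : 'V_n[A] -> 'V_n[A] -> A).
Hypothesis h_skew : skew_hermitian star h.
Hypothesis h_nondegenerate : form_nondegenerate h.
Local Notation V := ('V_n[A]).
Implicit Types (u v w x y z : V) (a b c e : A).

Let hlinr u a v w : h u (a *: v + w) = a * h u v + h u w.
Proof. by case: h_skew. Qed.

Lemma skew_form_sym u v : h v u = - star (h u v).
Proof. by case: h_skew. Qed.

Let hDr u v w : h u (v + w) = h u v + h u w.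
Proof. by have := hlinr u 1 v w; rewrite scale1r mul1r. Qed.

Let h0r u : h u 0 = 0.
Proof. by apply: (addrI (h u 0)); rewrite -hDr !addr0. Qed.

Let hZr u a v : h u (a *: v) = a * h u v.
Proof. by rewrite -[a *: v]addr0 hlinr h0r !addr0. Qed.

Let hNr u v : h u (- v) = - h u v.
Proof. by rewrite -scaleN1r hZr mulN1r. Qed.

Let hDl u v w : h (u + v) w = h u w + h v w.
Proof. by rewrite skew_form_sym hDr rmorphD opprD -!skew_form_sym. Qed.

Let hZl a u v : h (a *: u) v = star a * h u v.
Proof. by rewrite skew_form_sym hZr rmorphM -mulrN -skew_form_sym. Qed.

Let hNl u v : h (- u) v = - h u v.
Proof. by rewrite skew_form_sym hNr rmorphN [h u v in RHS]skew_form_sym. Qed.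

Let h0l u : h 0 u = 0.
Proof. by rewrite skew_form_sym h0r rmorph0 oppr0. Qed.

Let hE := (hDr, hDl, hZr, hZl, hNr, hNl, h0r, h0l).

Let star_norm v : star (h v v) = - h v v.
Proof. by rewrite [in RHS]skew_form_sym opprK. Qed.

Lemma norm_pi v : exists2 c, star c = c & h v v = pi * c.
Proof. exact: skew_pi. Qed.

Lemma form_mulmx u :
  {B : 'rV[A]_((2 * n).-1.+1) | forall x, h u x = (B *m x) 0 0}.
Proof.
exists (\row_j h u (delta_mx j 0)) => x; rewrite mxE {1}[x]matrix_sum_delta.
rewrite (big_morph (h u) (hDr u) (h0r u)); apply: eq_bigr => i _.
by rewrite big_ord1 hZr mxE mulrC.
Qed.

(** Nondegeneracy makes [g] injective, hence bijective on a finite set; the preimages of the basis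
    vectors are the columns of a right inverse. *)
Lemma isometry_unitmx (g : 'M[A]_((2 * n).-1.+1)) :
  (forall x y, h (g *m x) (g *m y) = h x y) -> g \in unitmx.
Proof.
move=> hg; have g_inj : injective (mulmx g : V -> V).
  by move=> x y eqxy; apply: h_nondegenerate => z; rewrite -hg eqxy hg.
have [f _ Kf] := injF_bij g_inj.
have : g *m (\matrix_(i, j) f (delta_mx j 0) i 0) = 1%:M.
  apply/matrixP => i j; have := congr1 (fun M : V => M i 0) (Kf (delta_mx j 0)).
  rewrite !mxE andbT => <-; apply: eq_bigr => m _; congr (_ * _).
  by rewrite mxE.
by case/mulmx1_unit.
Qed.

Lemma unitary_of_isometry (g : 'M[A]_((2 * n).-1.+1)) :
    (forall x y, h (g *m x) (g *m y) = h x y) ->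
  exists2 g', g' \in unitary h & GLval g' = g.
Proof.
move=> hg; have Ug : g \is a GRing.unit := isometry_unitmx hg.
exists (FinRing.Unit Ug : {'GL_(2 * n)[A]}) => //.
by rewrite inE; apply/forallP => x; apply/forallP => y; apply/eqP/hg.
Qed.

Lemma unitary_form g x y : g \in unitary h ->
  h (GLval g *m x) (GLval g *m y) = h x y.
Proof. by rewrite inE => /forallP/(_ x)/forallP/(_ y)/eqP. Qed.

(* The isometry is the transvection [x |-> x + h u v ^-1 h u x u] along
   [u = w - v]; it preserves [h] because [h v v = h w w]. *)
Lemma transvection v w : h w v \is a GRing.unit -> h v v = h w w ->
  exists2 g, g \in unitary h & w = GLval g *m v.
Proof.
move=> Uwv eqvw; have [u uE] : exists u, u = w - v by exists (w - v).
have [t tE] : exists t, t = h u v by exists (h u v).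
have Ut : t \is a GRing.unit.
  have [c _ vv] := norm_pi v.
  by rewrite tE uE !hE vv unitB_pi.
have uu : h u u = star t - t.
  rewrite tE uE !hE rmorphD rmorphN /= star_norm -eqvw [h v w]skew_form_sym.
  by ring.
have [B BE] := form_mulmx u.
pose g : 'M[A]_((2 * n).-1.+1) := 1%:M + t^-1 *: (u *m B).
have gE x : g *m x = x + (t^-1 * h u x) *: u.
  rewrite mulmxDl mul1mx -scalemxAl -mulmxA [B *m x]mx11_scalar -BE.
  by rewrite mul_mx_scalar scalerA.
have [x y|g' Ug' g'E] := unitary_of_isometry (g := g).
  rewrite !gE !hE uu [h x u]skew_form_sym rmorphM.
  have Ust : star t \is a GRing.unit by rewrite rmorph_unit.
  (* Multiplying by [t] and [star t] clears the inverses, which leaves a polynomial identity. *)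
  apply: (mulrI Ut); apply: (mulrI Ust).
  rewrite rmorphV //.
  have := mulrV Ut; have := mulrV Ust.
  move: (t^-1) (star t)^-1 => i i' si ii.
  transitivity (star t * t * h x y
      - (t * i) * star t * h u y * star (h u x)
      + (star t * i') * t * star (h u x) * h u y
      + (star t * i') * (t * i) * star (h u x) * h u y * (star t - t)).
    by ring.
  by rewrite si ii; ring.
by exists g' => //; rewrite g'E gE -tE mulVr // scale1r uE addrC subrK.
Qed.

Definition primitive_vector v := [exists z, h v z \is a GRing.unit].

(** The norm of the shifted vector leads to a quadratic equation with a fixed solution. The last
    clause ensures that the shift is invisible after scaling by [pi ^+ i] whenever the change of
    norm is. *)
Lemma adjust_norm v z a : h v z \is a GRing.unit -> star a = - a ->
  exists2 x : A, h (z + pi * x *: v) (z + pi * x *: v) = a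
    & forall i, pi ^+ i * a = pi ^+ i * h z z -> pi ^+ i * (pi * x) = 0.
Proof.
move=> Uvz skew_a; have [b bE] : exists b, b = h z v by exists (h z v).
have hvz : h v z = - star b by rewrite bE [LHS]skew_form_sym.
have Usb : star b \is a GRing.unit by rewrite -unitrN -hvz.
have Ub : b \is a GRing.unit by rewrite -[b]starK rmorph_unit.
have [c fc vvE] := norm_pi v.
have [|e fe eE] := @skew_pi (a - h z z).
  by rewrite rmorphB /= skew_a star_norm opprD opprK.
(* With [x = y / b] both cross terms equal [pi * y], and the norm of [v] contributes the quadratic
   term with this coefficient. *)
have [||y fy yE] := @fixed_quadratic_solution (pi * c / (b * star b)) e.
- rewrite !(rmorphM, rmorphV) ?unitrM ?Ub //= star_pi starK fc.
  by rewrite [star b * b]mulrC; ring.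
- by [].
have y_ann i : pi ^+ i * a = pi ^+ i * h z z -> pi ^+ i * (pi * (y / b)) = 0.
  (* The equation reads [y * D = e] with [D] a unit, so whatever kills [pi * e] kills [pi * y]. *)
  move=> eqa; have U2k := unitB_pi (pi * c / (b * star b) * y) two_unit.
  pose D := 2%:R - pi * (pi * c / (b * star b) * y).
  have -> : y = e / D by apply: (canRL (mulrK U2k)); rewrite -yE; ring.
  transitivity (pi ^+ i * (pi * e) / D / b); first by ring.
  by rewrite -eE mulrBr eqa subrr !mul0r.
exists (y / b) => //.
rewrite !hE hvz -bE vvE rmorphM rmorphM rmorphV // star_pi fy.
rewrite -[RHS](subrK (h z z)) eE -yE invrM //.
have := mulVr Ub; have := mulVr Usb; move: (b^-1) (star b)^-1 => i i' si ii.
transitivity (h z z + pi * y * (i * b) + pi * y * (i' * star b)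
    - pi * (pi * (pi * c * (i' * i))) * (y * y)).
  by ring.
by rewrite si ii; ring.
Qed.

Lemma primitive_dual v a : primitive_vector v -> star a = - a ->
  exists2 z, h v z \is a GRing.unit & h z z = a.
Proof.
case/existsP => z Uvz skew_a; have [x zE _] := adjust_norm Uvz skew_a.
exists (z + pi * x *: v) => //; have [c _ vv] := norm_pi v.
by rewrite !hE vv -mulrA unitD_pi.
Qed.

Lemma hyperbolic_partner v :
  primitive_vector v -> exists2 z, h v z = 1 & h z z = 0.
Proof.
move=> /(@primitive_dual _ 0)[|z Uvz zz]; first by rewrite rmorph0 oppr0.
by exists ((h v z)^-1 *: z); rewrite !hE ?mulVr // zz !mulr0.
Qed.

(** When [h w v] is not a unit, two transvections are composed through a vector of the same norm
    that pairs to units with both [v] and [w]. *)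
Lemma primitive_orbit v w : primitive_vector v -> primitive_vector w ->
  h v v = h w w -> exists2 g, g \in unitary h & w = GLval g *m v.
Proof.
move=> pv pw eqvw.
have [Uwv | /nonunit_pi[b wvE]] := boolP (h w v \is a GRing.unit).
  exact: transvection.
have [z Uvz Uwz] : exists2 z, h v z \is a GRing.unit & h w z \is a GRing.unit.
  have /existsP[z1 U1] := pv; have /existsP[z2 U2] := pw.
  have [U1' | /nonunit_pi[b1 E1]] := boolP (h w z1 \is a GRing.unit).
    by exists z1.
  have [U2' | /nonunit_pi[b2 E2]] := boolP (h v z2 \is a GRing.unit).
    by exists z2.
  exists (z1 + z2); rewrite hDr ?E2 ?unitD_pi //.
  by rewrite E1 addrC unitD_pi.
have [x zzE _] := adjust_norm Uvz (star_norm v).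
have [c _ vvE] := norm_pi v.
have Uzv : h (z + pi * x *: v) v \is a GRing.unit.
  rewrite skew_form_sym unitrN rmorph_unit // !hE vvE -mulrA.
  by rewrite unitD_pi.
have Uwz' : h w (z + pi * x *: v) \is a GRing.unit.
  by rewrite !hE wvE -mulrA unitD_pi.
have [g1 Ug1 zE] := transvection Uzv (esym zzE).
have [g2 Ug2 wE] := transvection Uwz' (etrans zzE eqvw).
exists (g2 * g1)%g; first exact: (groupM (G := unitary_group h)).
by rewrite wE zE GL_MxE mulmxA.
Qed.

Lemma primitive_unitary g v : g \in unitary h ->
  primitive_vector v -> primitive_vector (GLval g *m v).
Proof.
move=> Ug /existsP[z Uvz]; apply/existsP; exists (GLval g *m z).
by rewrite unitary_form.
Qed.

Lemma primitive_scale_neq0 i v :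
  (i < L)%N -> primitive_vector v -> pi ^+ i *: v != 0.
Proof.
move=> ltiL /existsP[z Uvz]; apply/eqP => /(congr1 (fun x => h z x)).
rewrite h0r hZr => /pi_exp_eq0[] // b; rewrite skew_form_sym => zvE.
have := pi_nonunit b; rewrite -zvE unitrN.
by rewrite rmorph_unit.
Qed.

(** If all [h v z] are nonunits, then [pi ^+ L.-1 *: v] is orthogonal to everything, hence zero, so
    no coordinate of [v] is a unit. *)
Lemma nonprimitive_pi v : ~~ primitive_vector v -> exists w, v = pi *: w.
Proof.
move=> Nv; have [U|] := boolP [exists i, v i 0 \is a GRing.unit]; last first.
  rewrite negb_exists => /forallP nU.
  have /fin_all_exists[w wE] i : exists b, v i 0 = pi * b by apply: nonunit_pi.
  exists (\col_i w i); apply/matrixP => i j; rewrite ord1 !mxE.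
  exact: wE.
have /existsP[i Uvi] := U; have ltL : (L.-1 < L)%N.
  by case: (L) piL => [/eqP|//]; rewrite expr0 oner_eq0.
have : pi ^+ L.-1 *: v = 0.
  apply: h_nondegenerate => z; rewrite h0l hZl.
  have /nonunit_pi[b ->] : h v z \isn't a GRing.unit.
    by apply: contra Nv => Uvz; apply/existsP; exists z.
  rewrite rmorphXn star_pi exprNn mulrA -(mulrA ((-1) ^+ _)) -exprSr.
  by rewrite prednK ?piL ?mulr0 ?mul0r // (leq_ltn_trans _ ltL).
move/matrixP/(_ i 0); rewrite !mxE => /pi_exp_eq0[] // b vi.
by have := pi_nonunit b; rewrite -vi Uvi.
Qed.

Lemma level_exists v : v != 0 ->
  exists i : 'I_L, exists2 w, primitive_vector w & v = pi ^+ i *: w.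
Proof.
move=> v0; pose P i := (i <= L)%N && [exists w, v == pi ^+ i *: w].
have exP : exists i, P i.
  by exists 0%N; apply/existsP; exists v; rewrite expr0 scale1r.
have leP i : P i -> (i <= L)%N by case/andP.
case: (ex_maxnP exP leP) => i /andP[leiL /existsP[w /eqP vE]] maxi.
have ltiL : (i < L)%N.
  rewrite ltn_neqAle leiL andbT; apply: contraNneq v0 => iL.
  by rewrite vE iL piL scale0r.
exists (Ordinal ltiL), w => //.
have [// | /nonprimitive_pi[w' wE]] := boolP (primitive_vector w).
have /maxi : P i.+1.
  by rewrite /P ltiL; apply/existsP; exists w'; rewrite vE wE scalerA -exprSr.
by rewrite ltnn.
Qed.

Lemma level_inj (i j : 'I_L) v w : primitive_vector v -> primitive_vector w ->
  pi ^+ i *: v = pi ^+ j *: w -> i = j.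
Proof.
wlog ltij : i j v w / (i < j)%N => [wlg pv pw eqvw | pv pw eqvw].
  apply: val_inj; have [ltij|ltji|//] := ltngtP i j.
    by rewrite (wlg i j v w).
  by rewrite (wlg j i w v).
have ltL : (L.-1 < L)%N by rewrite prednK // (leq_ltn_trans _ (ltn_ord i)).
(* Multiplication by [pi ^+ (L.-1 - i)] kills the vector of the higher level [j] but not the one of
   level [i]. *)
have := primitive_scale_neq0 ltL pv; rewrite (_ : L.-1 = L.-1 - i + i)%N.
  rewrite exprD -scalerA eqvw scalerA -exprD.
  rewrite (_ : _ + j = L + (j - i.+1))%N ?exprD ?piL ?mul0r ?scale0r ?eqxx //.
  by have := ltn_ord i; lia.
by have := ltn_ord i; lia.
Qed.

(** The equality is used once in each argument of [h]. Passing to the first argument costs a [star],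
    harmless since it sends [pi ^+ i] to itself up to sign. *)
Lemma scaled_norm i v w :
  pi ^+ i *: v = pi ^+ i *: w -> pi ^+ i * h v v = pi ^+ i * h w w.
Proof.
move=> eqvw; have starC a b :
    pi ^+ i * a = pi ^+ i * b -> pi ^+ i * star a = pi ^+ i * star b.
  move/(congr1 star); rewrite !rmorphM rmorphXn star_pi exprNn -!mulrA.
  by move/mulrI; apply; rewrite unitrX // unitrN unitr1.
rewrite -[LHS]hZr eqvw hZr [h v w]skew_form_sym [h w w]skew_form_sym !mulrN.
congr (- _).
by apply: starC; rewrite -!hZr eqvw.
Qed.

(* [None] for [v = 0]; for [v = pi ^+ i *: w] with [w] primitive, the level [i]
   and [pi ^+ i * h w w], which does not depend on the choice of [w]. *)
Definition orbit_class v : option ('I_L * A) :=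
  omap (fun p : 'I_L * V => (p.1, pi ^+ p.1 * h p.2 p.2))
    [pick p : 'I_L * V | primitive_vector p.2 && (v == pi ^+ p.1 *: p.2)].

Lemma orbit_class_scale (i : 'I_L) w : primitive_vector w ->
  orbit_class (pi ^+ i *: w) = Some (i, pi ^+ i * h w w).
Proof.
move=> pw; rewrite /orbit_class; case: pickP => [[j x] /= /andP[px /eqP eqwx]|].
  have eqij := level_inj pw px eqwx; rewrite -eqij in eqwx *.
  by rewrite (scaled_norm eqwx).
by move/(_ (i, w)); rewrite /= pw eqxx.
Qed.

Lemma orbit_class0 : orbit_class 0 = None.
Proof.
rewrite /orbit_class; case: pickP => [[j x] /= /andP[px]|//].
by rewrite eq_sym (negPf (primitive_scale_neq0 _ px)).
Qed.

Lemma orbit_classP u v :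
  orbit_class u = orbit_class v <->
  exists2 g, g \in unitary h & v = GLval g *m u.
Proof.
split=> [|[g Ug ->]]; last first.
  have [-> | /level_exists[i [w pw ->]]] := eqVneq u 0; first by rewrite mulmx0.
  rewrite -scalemxAr !orbit_class_scale ?unitary_form //.
  exact: primitive_unitary.
have [-> | /level_exists[i [w pw ->]]] := eqVneq u 0;
  have [-> | /level_exists[j [x px ->]]] := eqVneq v 0;
  rewrite ?orbit_class0 ?orbit_class_scale //.
  by exists 1%g; rewrite ?(group1 (unitary_group h)) // GL_1E mul1mx.
case=> <-{j} eqwx; have /existsP[z Uxz] := px.
have Uzx : h z x \is a GRing.unit by rewrite skew_form_sym unitrN rmorph_unit.
(* [x] is moved to [x + pi * c *: z], which has the norm of [w] and the same multiple by
   [pi ^+ i]. *)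
have [c norm_w /(_ i eqwx) cE] := adjust_norm Uzx (star_norm w).
have [|||g Ug wE] := @primitive_orbit w (x + pi * c *: z) => //.
  apply/existsP; exists z; rewrite hDl hZl rmorphM star_pi.
  by rewrite !mulNr -mulrA unitB_pi.
by exists g => //; rewrite -scalemxAr -wE scalerDr scalerA cE scale0r addr0.
Qed.

Lemma scale_nonprimitive v : ~~ primitive_vector (pi *: v).
Proof.
apply/existsPn => z; rewrite hZl star_pi mulNr unitrN; exact: pi_nonunit.
Qed.

Lemma primitive_exists : exists v, primitive_vector v.
Proof.
exists (delta_mx 0 0).
have [// | /nonprimitive_pi[w /matrixP/(_ 0 0)]] := boolP (primitive_vector _).
by rewrite !mxE eqxx => E; have := pi_nonunit (w 0 0); rewrite -E unitr1.
Qed.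

Lemma card_orbit_classes :
  #|orbit_class @: setT| = ((\sum_(i < L) #|pi_fixed i.+1|).+1)%N.
Proof.
pose Z := [set p : 'I_L * A | p.2 \in pi_fixed p.1.+1].
have -> : orbit_class @: setT = None |: (Some @: Z).
  apply/setP => o; rewrite !inE; apply/imsetP/idP.
    case=> v _ ->; have [-> | /level_exists[i [w pw ->]]] := eqVneq v 0.
      by rewrite orbit_class0.
    rewrite orbit_class_scale //; apply: imset_f; rewrite inE /=.
    have [r fr ->] := norm_pi w; apply/pi_fixedP; exists r => //.
    by rewrite exprSr mulrA.
  case/predU1P => [-> | /imsetP[[i a] +] ->].
    by exists 0; rewrite ?inE ?orbit_class0.
  rewrite inE => /pi_fixedP[r fr /= aE].
  have [v pv] := primitive_exists.
  (* Every skew element is the norm of a primitive vector, so each label in [Z] occurs. *)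
  have [|z Uvz zz] := @primitive_dual v (pi * r) pv.
    by rewrite rmorphM star_pi fr mulNr.
  have pz : primitive_vector z.
    by apply/existsP; exists v; rewrite skew_form_sym unitrN rmorph_unit.
  exists (pi ^+ i *: z); rewrite ?inE // orbit_class_scale //.
  by rewrite zz aE exprSr mulrA.
rewrite cardsU1 card_imset; last by move=> ? ? [].
have /negPf-> : None \notin Some @: Z by apply/imsetP => -[].
rewrite add1n; congr _.+1; rewrite /Z -sum1dep_card.
rewrite -(pair_big_dep xpredT (fun (i : 'I_L) a => a \in pi_fixed i.+1)
  (fun _ _ => 1%N)) /=.
by apply: eq_bigr => i _; rewrite sum1_card.
Qed.

(** * Twists of a hyperbolic plane *)

Section Twist.
Variables (w0 z : V).
Hypotheses (w0z : h w0 z = 1) (zz : h z z = 0).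

(** [alpha] and [beta] read off the coordinates of [u] along [w0] and [z]; the correction in [beta]
    is due to the norm of [w0]. *)
Let alpha u := - h z u.
Let beta u := h w0 u - alpha u * h w0 w0.

(* For [u = a w0 + b z + y] with [y] orthogonal to [w0] and [z], this is
   [e a^* w0 - e b^* z + y], where [e = (-1) ^ j]. *)
Definition plane_twist (j : nat) u : V :=
  u + ((-1) ^+ j * star (alpha u) - alpha u) *: w0
    - (beta u + (-1) ^+ j * star (beta u)) *: z.

Let zw0 : h z w0 = -1. Proof. by rewrite skew_form_sym w0z rmorph1. Qed.

Let hplane := (w0z, zz, zw0).

Let alphaD u v : alpha (u + v) = alpha u + alpha v.
Proof. by rewrite /alpha hDr opprD. Qed.

Let betaD u v : beta (u + v) = beta u + beta v.
Proof. by rewrite /beta hDr alphaD; ring. Qed.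

Let alphaZ a u : alpha (a *: u) = a * alpha u.
Proof. by rewrite /alpha hZr mulrN. Qed.

Let betaZ a u : beta (a *: u) = a * beta u.
Proof. by rewrite /beta hZr alphaZ; ring. Qed.

Lemma plane_twistD j u v :
  plane_twist j (u + v) = plane_twist j u + plane_twist j v.
Proof.
rewrite /plane_twist alphaD betaD !rmorphD /=.
by apply/matrixP => i k; rewrite !mxE; ring.
Qed.

(** The twist is only semilinear on the plane: [star] changes [pi ^+ i] by [(-1) ^+ i], which the
    shifted exponent absorbs. *)
Lemma plane_twist_scale j i u :
  plane_twist j (pi ^+ i *: u) = pi ^+ i *: plane_twist (j + i) u.
Proof.
rewrite /plane_twist alphaZ betaZ !rmorphM rmorphXn star_pi.
rewrite [(- pi) ^+ _]exprNn exprD /=.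
move: ((-1) ^+ i) ((-1) ^+ j) => e e'.
by apply/matrixP => m k; rewrite !mxE; ring.
Qed.

Lemma plane_twist0 j : plane_twist j 0 = 0.
Proof. by apply: (addrI (plane_twist j 0)); rewrite -plane_twistD !addr0. Qed.

Lemma plane_twistN j u : plane_twist j (- u) = - plane_twist j u.
Proof.
by apply/eqP; rewrite -addr_eq0 -plane_twistD addNr plane_twist0.
Qed.

Let alpha_twist j u : alpha (plane_twist j u) = (-1) ^+ j * star (alpha u).
Proof. by rewrite {1}/alpha /plane_twist !hE !hplane /alpha; ring. Qed.

Let beta_twist j u : beta (plane_twist j u) = - ((-1) ^+ j * star (beta u)).
Proof.
rewrite {1}/beta alpha_twist /plane_twist !hE !hplane mulr1.
rewrite (_ : h w0 u = beta u + alpha u * h w0 w0); last by rewrite /beta subrK.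
by ring.
Qed.

Let sign_star j : star ((-1) ^+ j) = (-1) ^+ j.
Proof. by rewrite rmorphXn rmorphN1. Qed.

Lemma plane_twistK j : involutive (plane_twist j).
Proof.
move=> u; rewrite [LHS]/plane_twist alpha_twist beta_twist /plane_twist.
move: (alpha u) (beta u) => a b.
rewrite !(rmorphN, rmorphM) /= !starK sign_star.
apply/matrixP => i k; rewrite !mxE -signr_odd.
by case: (odd j); rewrite ?expr1 ?expr0; ring.
Qed.

(** On the plane the twist exchanges the cross terms [star a * b] and [- star b * a], since [A] is
    commutative. *)
Lemma plane_twist_norm j u : h (plane_twist j u) (plane_twist j u) = h u u.
Proof.
rewrite /plane_twist !hE !hplane.
rewrite (_ : h u w0 = - star (h w0 u)); last exact: skew_form_sym.
rewrite (_ : h u z = star (alpha u)); last by rewrite rmorphN -skew_form_sym.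
rewrite (_ : h z u = - alpha u); last by rewrite opprK.
rewrite (_ : h w0 u = beta u + alpha u * h w0 w0); last by rewrite /beta subrK.
move: (alpha u) (beta u) => a b.
rewrite !(rmorphD, rmorphN, rmorphM) /= !starK sign_star star_norm.
rewrite -signr_odd; case: (odd j); rewrite ?expr1 ?expr0; ring.
Qed.

Lemma plane_twist_form j u : h (plane_twist j u) w0 = (-1) ^+ j * h w0 u.
Proof.
have -> : h w0 u = beta u + alpha u * h w0 w0 by rewrite /beta subrK.
rewrite skew_form_sym /plane_twist !hE !hplane.
have -> : h w0 u = beta u + alpha u * h w0 w0 by rewrite /beta subrK.
move: (alpha u) (beta u) => a b.
rewrite !(rmorphD, rmorphN, rmorphM) /= !starK sign_star star_norm rmorph1.
by ring.
Qed.

Lemma plane_twist_fix j : plane_twist j w0 = (-1) ^+ j *: w0.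
Proof.
rewrite /plane_twist /beta /alpha zw0 opprK rmorph1 mul1r subrr rmorph0.
by rewrite mulr1 mulr0 addr0 scale0r subr0 scalerBl scale1r addrC subrK.
Qed.

Lemma plane_twist_class j u : orbit_class (plane_twist j u) = orbit_class u.
Proof.
have [-> | /level_exists[i [v pv ->]]] := eqVneq u 0.
  by rewrite plane_twist0.
rewrite plane_twist_scale !orbit_class_scale ?plane_twist_norm //.
have [// | /nonprimitive_pi[v' v'E]] :=
  boolP (primitive_vector (plane_twist (j + i) v)).
(* Were the twist of [v] a multiple of [pi], twisting back would make [v] one too. *)
have := scale_nonprimitive (plane_twist (j + i + 1) v').
rewrite -[pi in pi *: _]expr1 -plane_twist_scale expr1 -v'E plane_twistK.
by rewrite pv.
Qed.

End Twist.

Lemma orbit_twist w : exists2 sigma : V -> V, injective sigma &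
  forall u, [/\ orbit_class (sigma u) = orbit_class u,
                orbit_class (w - sigma u) = orbit_class (w - u)
              & h (sigma u) w = h w u].
Proof.
have [-> | /level_exists[i [w0 pw0 ->]]] := eqVneq w 0.
  by exists id => // u; rewrite h0l h0r.
have [z w0z zz] := hyperbolic_partner pw0.
(* Taking the level [i] as sign exponent makes the sign on [pi ^+ i *: w0] equal to
   [(-1) ^+ (i + i) = 1]. *)
exists (plane_twist w0 z i) => [|u].
  exact: can_inj (plane_twistK w0z zz i).
split; first exact: plane_twist_class.
  have wE : plane_twist w0 z i (pi ^+ i *: w0) = pi ^+ i *: w0.
    rewrite plane_twist_scale plane_twist_fix // exprD -expr2 sqrr_sign.
    by rewrite scale1r.
  by rewrite -{1}wE -plane_twistN -plane_twistD plane_twist_class.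
rewrite hZr hZl plane_twist_form // rmorphXn star_pi [(- pi) ^+ _]exprNn.
by rewrite mulrA [pi ^+ _ * _]mulrC.
Qed.

End UnitaryOrbits.
End ChainRing.

(** * The rings A and R *)

Section QuadraticQuotient.
Variables (O : comNzRingType) (s : O).
Local Notation Q := {poly %/ 'X^2 - s%:P}.
Local Notation C := (qpolyC ('X^2 - s%:P)).
Local Notation t := (qpolyX ('X^2 - s%:P)).

Let mk_monicE : mk_monic ('X^2 - s%:P) = 'X^2 - s%:P.
Proof. by rewrite /mk_monic size_XnsubC // monicXnsubC. Qed.

Lemma in_qpoly_const c : in_qpoly ('X^2 - s%:P) c%:P = C c.
Proof.
apply/val_inj/in_qpoly_small; rewrite mk_monicE size_XnsubC //.
by rewrite (leq_ltn_trans (size_polyC_leq1 c)).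
Qed.

Lemma qpolyC_in_qpolyX a b : C a + C b * t = in_qpoly _ (a%:P + b%:P * 'X).
Proof. by rewrite rmorphD rmorphM /= !in_qpoly_const. Qed.

Lemma quadratic_decomp (x : Q) : exists a b, x = C a + C b * t.
Proof.
exists (val x)`_0, (val x)`_1; rewrite qpolyC_in_qpolyX.
have szx : (size (val x : {poly O}) < 3)%N.
  apply: leq_trans (size_mk_monic x) _.
  by rewrite mk_monicE size_XnsubC.
rewrite -[LHS](_ : in_qpoly _ (val x) = x); last first.
  by apply/val_inj/in_qpoly_small/size_mk_monic.
congr in_qpoly.
apply/polyP => -[|[|i]]; rewrite !(coefD, coefC, coefCM, coefX) /=.
- by rewrite mulr0 addr0.
- by rewrite mulr1 add0r.
by rewrite mulr0 addr0 nth_default // (leq_trans (ltnSE szx)).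
Qed.

Lemma quadratic_coef_inj a b a' b' :
  C a + C b * t = C a' + C b' * t -> a = a' /\ b = b'.
Proof.
have small (c d : O) :
      (size (c%:P + d%:P * 'X)%R < size (mk_monic ('X^2 - s%:P)%R))%N.
  rewrite mk_monicE size_XnsubC // ltnS addrC size_MXaddC.
  by case: ifP => // _; rewrite ltnS size_polyC_leq1.
rewrite !qpolyC_in_qpolyX => /(congr1 val).
rewrite /= !Pdiv.CommonRing.rmodp_small // => E.
have := congr1 (fun p : {poly O} => p`_0) E.
have := congr1 (fun p : {poly O} => p`_1) E.
by rewrite !(coefD, coefC, coefCM, coefX) /= !(mulr0, mulr1, addr0, add0r).
Qed.

Lemma qX_sqr : t ^+ 2 = C s.
Proof.
have E : in_qpoly ('X^2 - s%:P) ('X^2 - s%:P) = 0.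
  apply: val_inj; rewrite /= -{1}mk_monicE.
  by rewrite Pdiv.RingMonic.rmodpp // monic_mk_monic.
by rewrite -in_qpoly_const -[RHS]add0r -E -rmorphD subrK rmorphXn.
Qed.

End QuadraticQuotient.

Lemma nilpotent_unit (A : comUnitRingType) (x : A) n :
  x ^+ n = 0 -> 1 - x \is a GRing.unit.
Proof.
move=> xn; apply/unitrPr; exists (\sum_(i < n) x ^+ i).
by rewrite -opprB mulNr -subrX1 xn sub0r opprK.
Qed.

(** * From the presentation over [O] to the chain ring properties *)

Section Presentation.
Variables (O : idomainType) (s : O).
Variables (Q : comNzRingType) (C : {rmorphism O -> Q}) (t : Q).
Hypothesis t_sqr : t ^+ 2 = C s.
Hypothesis Q_decomp : forall x, exists a b, x = C a + C b * t.
Hypothesis Q_coef_inj : forall a b a' b',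
  C a + C b * t = C a' + C b' * t -> a = a' /\ b = b'.

Lemma t_expD m : t ^+ (2 * m) = C (s ^+ m).
Proof. by rewrite exprM t_sqr rmorphXn. Qed.

(* [(s ^ m t) (c + e t) = s ^ (m + 1) e + s ^ m c t]. *)
Lemma multiples_t_odd m a b :
    multiples (t ^+ (2 * m).+1) (C a + C b * t) ->
  multiples (s ^+ m.+1) a /\ multiples (s ^+ m) b.
Proof.
case=> x; have [c [e ->]] := Q_decomp x; rewrite exprSr t_expD => E.
have [-> ->] : a = e * s ^+ m.+1 /\ b = c * s ^+ m.
  apply: Q_coef_inj; rewrite E !rmorphM exprSr rmorphM -t_sqr /=.
  by ring.
by split; [exists e | exists c].
Qed.

Hypothesis O_local : local_with_maximal_ideal (multiples s).
Hypothesis O_not_field : ~ GRing.field_axiom O.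
Variables (k : finFieldType) (res : {rmorphism O -> k}).
Hypothesis res_quotient : is_quotient res (multiples s).
Hypothesis k_odd : forall p, p \in [pchar k] -> odd p.
Variables (m : nat) (R : finComUnitRingType) (toR : {rmorphism O -> R}).
Hypothesis R_quotient : is_quotient toR (multiples (s ^+ m.+1)).
Variables (A : finComUnitRingType).
Variable toA : {rmorphism Q -> A}.
Hypothesis A_quotient : is_quotient toA (multiples (t ^+ (2 * m).+1)).
Variable iota : {rmorphism R -> A}.
Hypothesis iotaE : forall x, iota (toR x) = toA (C x).
Variable star : {rmorphism A -> A}.
Hypothesis star_iota : forall r, star (iota r) = iota r.
Hypothesis star_pi : star (toA t) = - toA t.

Local Notation pi := (toA t).

Lemma uniformizer_not_unit : ~ multiples s 1.
Proof. by case: O_local.1. Qed.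

(** If [s] vanished, [res] would be an isomorphism onto the field [k]. *)
Lemma uniformizer_neq0 : s != 0.
Proof.
apply/eqP => s0; apply: O_not_field => x x0.
have [res_surj res_ker] := res_quotient.
have [y resy] := res_surj (res x)^-1.
have res0 z : res z = 0 -> z = 0 by move/res_ker => [b ->]; rewrite s0 mulr0.
apply/unitrPr; exists y; apply/eqP; rewrite -subr_eq0; apply/eqP/res0.
rewrite rmorphB rmorphM rmorph1 resy mulfV ?subrr //.
by apply: contraNneq x0 => /res0->.
Qed.

Lemma multiples_cancel i b :
  multiples (s ^+ i.+1) (s * b) -> multiples (s ^+ i) b.
Proof.
case=> c E; exists c; apply: (mulfI uniformizer_neq0); rewrite E exprS; ring.
Qed.

Lemma iota_decomp a : exists x y, a = iota x + pi * iota y.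
Proof.
have [toA_surj _] := A_quotient; have [x <-] := toA_surj a.
have [c [e ->]] := Q_decomp x.
by exists (toR c), (toR e); rewrite !iotaE rmorphD rmorphM /= [pi * _]mulrC.
Qed.

Lemma iota_inj : injective iota.
Proof.
suff iota0 r : iota r = 0 -> r = 0.
  move=> r r' E; apply/eqP; rewrite -subr_eq0; apply/eqP/iota0.
  by rewrite rmorphB /= E subrr.
have [toR_surj toR_ker] := R_quotient.
have [x <-] := toR_surj r; rewrite iotaE => /(A_quotient.2 _).1 xA.
apply/toR_ker; have [] // := @multiples_t_odd m x 0.
by rewrite rmorph0 mul0r addr0.
Qed.

Lemma pi_exp : pi ^+ (2 * m).+1 = 0.
Proof. by rewrite -rmorphXn; apply/A_quotient.2; exists 1; rewrite mul1r. Qed.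

Lemma pi_exp_neq0 : pi ^+ (2 * m) != 0.
Proof.
apply/eqP; rewrite -rmorphXn t_expD => /(A_quotient.2 _).1 E.
have [|[c E'] _] := @multiples_t_odd m (s ^+ m) 0.
  by rewrite rmorph0 mul0r addr0.
case: uniformizer_not_unit; exists c.
apply: (mulIf (expf_neq0 m uniformizer_neq0)); rewrite mul1r {1}E' exprS; ring.
Qed.

(** Multiplying by a lift of the inverse residue gives 1 minus a multiple of the nilpotent [pi]. *)
Lemma unit_of_res c e : res c != 0 ->
  toA (C c + C e * t) \is a GRing.unit.
Proof.
move=> resc; have [c' resc'] := res_quotient.1 (res c)^-1.
have [b bE] : multiples s (1 - c * c').
  by apply/res_quotient.2; rewrite rmorphB rmorphM rmorph1 resc' mulfV ?subrr.
suff : toA (C c + C e * t) * toA (C c') \is a GRing.unit.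
  by rewrite unitrM => /andP[].
pose x := pi * (toA (C b) * pi - toA (C (e * c'))).
have -> : toA (C c + C e * t) * toA (C c') = 1 - x.
  rewrite -rmorphM mulrDl -rmorphM -[c * c'](subKr 1) bE rmorphB rmorph1.
  rewrite [C (b * s)]rmorphM -t_sqr /x !rmorphD !rmorphN !rmorphM /= rmorph1.
  by ring.
by apply: (@nilpotent_unit _ _ (2 * m).+1); rewrite exprMn pi_exp mul0r.
Qed.

Lemma toA_nonunit a : a \isn't a GRing.unit -> exists b, a = pi * b.
Proof.
have [x <-] := A_quotient.1 a; have [c [e ->]] := Q_decomp x.
move=> nU; have /eqP : res c == 0 by apply: contraR nU; apply: unit_of_res.
case/(res_quotient.2 _).1 => b ->.
exists (toA (C b * t + C e)); rewrite -rmorphM; congr (toA _).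
by rewrite rmorphM -t_sqr /=; ring.
Qed.

Lemma res_two_neq0 : res 2%:R != 0.
Proof.
rewrite rmorph_nat; apply/negP => two0.
by have := k_odd (p := 2%N); rewrite inE /= two0 => /(_ isT).
Qed.

Lemma two_unit : (2%:R : A) \is a GRing.unit.
Proof.
have := unit_of_res 0 res_two_neq0.
by rewrite rmorph0 mul0r addr0 !rmorph_nat.
Qed.

Lemma star_iota_pi x y : star (iota x + pi * iota y) = iota x - pi * iota y.
Proof. by rewrite rmorphD rmorphM !star_iota star_pi mulNr. Qed.

Lemma star_involutive : involutive star.
Proof.
move=> a; have [x [y ->]] := iota_decomp a.
by rewrite star_iota_pi rmorphB rmorphM !star_iota star_pi mulNr opprK.
Qed.

Lemma star_congruent a : exists b, a - star a = pi * b.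
Proof.
have [x [y ->]] := iota_decomp a; exists (iota y + iota y).
by rewrite star_iota_pi; ring.
Qed.

Lemma star_fixed a : star a = a -> exists x, a = iota x.
Proof.
have [x [y ->]] := iota_decomp a; rewrite star_iota_pi => E; exists x.
have : 2%:R * (pi * iota y) = 2%:R * 0.
  rewrite mulr0 mulr_natl mulr2n; apply: (addrI (iota x - pi * iota y)).
  by rewrite addr0 addrA subrK -E.
by move/(mulrI two_unit) => ->; rewrite addr0.
Qed.

(** A fixed [y] comes from some [x] in [O]; cancelling [s] makes [x] a multiple of [s ^+ m], and [t]
    times that vanishes in [A]. *)
Lemma real_part_pi y : iota (toR s) * y = 0 -> star y = y -> pi * y = 0.
Proof.
move=> + fy; have [r ->] := star_fixed fy; have [x <-] := R_quotient.1 r.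
move=> E0; have /(R_quotient.2 _).1 E : toR (s * x) = 0.
  by apply: iota_inj; rewrite rmorph0 !rmorphM.
have [b ->] := multiples_cancel E.
suff /(A_quotient.2 _).2 : multiples (t ^+ (2 * m).+1) (t * C (b * s ^+ m)).
  by rewrite rmorphM iotaE.
by exists (C b); rewrite rmorphM -t_expD exprSr; ring.
Qed.

Lemma residue_lift : exists lift : k -> A,
  [/\ forall c, star (lift c) = lift c,
      forall r, star r = r -> exists c b, r = lift c + pi * b
    & forall c c', c != c' -> lift c - lift c' \is a GRing.unit].
Proof.
have /fin_all_exists[lift liftK] : forall c, exists x, res x = c.
  exact: res_quotient.1.
exists (fun c => iota (toR (lift c))).
split=> [c | r /star_fixed[y ->] | c c' cc'].
- exact: star_iota.
- have [x <-] := R_quotient.1 y; exists (res x).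
  have [b xE] : multiples s (x - lift (res x)).
    by apply/res_quotient.2; rewrite rmorphB /= liftK subrr.
  exists (pi * toA (C b)); rewrite -[x in LHS](subrK (lift (res x))) xE addrC.
  rewrite !rmorphD !iotaE; congr (_ + _).
  by rewrite rmorphM -t_sqr !rmorphM /=; ring.
have := @unit_of_res (lift c - lift c') 0.
rewrite rmorph0 mul0r addr0 !rmorphB /= !liftK subr_eq0 !iotaE; exact.
Qed.

(** * The form [f] and the Weil representation *)

Section WeilRepresentation.
Variables (n : nat) (h : 'V_n[A] -> 'V_n[A] -> A).
Hypothesis h_skew : skew_hermitian star h.
Hypothesis h_nondegenerate : form_nondegenerate h.
Variable f : biadditive 'V_n[A] R.
Hypothesis fE : forall v w, iota (f v w) = (h v w + star (h v w)) / 2%:R.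
Variables (F : numClosedFieldType) (lambda : R -> F).
Hypothesis lambda_character : linear_character lambda.
Hypothesis lambda_primitive : primitive_character lambda.

Let hZr u a v : h u (a *: v) = a * h u v.
Proof.
case: h_skew => hlin _ _; have h0 : h u 0 = 0.
  apply: (addrI (h u 0)); rewrite addr0; have := hlin u 1 0 0.
  by rewrite scale1r addr0 mul1r.
by rewrite -[a *: v]addr0 hlin h0 !addr0.
Qed.

Let h_sym u v : h v u = - star (h u v).
Proof. by case: h_skew. Qed.

Lemma f_alternating u v : f v u = - f u v.
Proof.
apply: iota_inj; rewrite rmorphN /= !fE (h_sym u v) rmorphN star_involutive.
by ring.
Qed.

(** The vanishing of [f v] makes each [h v u] skew, say [pi * y] with [y] fixed. The same at
    [pi *: u] gives [pi ^+ 2 * y = 0], hence [pi * y = 0]. *)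
Lemma f_eq0 v : (forall u, f v u = 0) -> v = 0.
Proof.
have hv0 : h v 0 = 0 by rewrite -(scale0r 0) hZr mul0r.
move=> fv0; apply: h_nondegenerate => u.
have real0 w : star (h v w) = - h v w.
  have : iota (f v w) * 2%:R = 0 by rewrite fv0 rmorph0 mul0r.
  by rewrite fE mulrVK ?two_unit // => /eqP; rewrite addrC addr_eq0 => /eqP.
have [y fy hvu] :=
  skew_pi star_involutive star_pi two_unit star_congruent (real0 u).
rewrite hvu [RHS]h_sym -(scale0r 0) hZr mul0r rmorph0 oppr0.
apply: real_part_pi => //; rewrite iotaE -t_sqr rmorphXn.
have := real0 (pi *: u); rewrite hZr hvu !rmorphM star_pi fy => E.
apply: (mulrI two_unit); rewrite mulr0 expr2.
transitivity (- pi * (- pi * y) + pi * (pi * y)); first by ring.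
by rewrite E addNr.
Qed.

Lemma f_diag u : f u u = 0.
Proof.
apply: iota_inj; rewrite fE rmorph0 {1}h_sym.
by rewrite addNr mul0r.
Qed.

Lemma f_scale r u v : f v (iota r *: u) = r * f v u.
Proof.
by apply: iota_inj; rewrite rmorphM !fE hZr rmorphM star_iota; ring.
Qed.

(** Otherwise [lambda] agrees at [f v u] and its opposite for all [u]; halving [u] shows it trivial
    on the ideal of values of [f v], which is then zero. *)
Lemma character_separates v :
  v != 0 -> exists u, lambda (f u v) != lambda (f v u).
Proof.
move=> v0; apply/existsP; apply: contraNT v0 => /existsPn lam_eq.
have [lam0 lamD] := lambda_character.
have f0 : f v 0 = 0 by apply: (addrI (f v 0)); rewrite -biadditiveDr !addr0.
apply/eqP/f_eq0 => u.
apply: (lambda_primitive (I := fun x => exists u, x = f v u)).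
- split=> [|_ _ [u1 ->] [u2 ->]|r _ [u1 ->]].
  + by exists 0; rewrite f0.
  + by exists (u1 + u2); rewrite biadditiveDr.
  + by exists (iota r *: u1); rewrite f_scale.
- move=> _ [u1 ->]; pose w : 'V_n[A] := 2%:R^-1 *: u1.
  have -> : u1 = w + w.
    rewrite -scalerDl -mulr2n -[2%:R^-1 *+ 2]mulr_natl.
    by rewrite mulrV ?two_unit // scale1r.
  have /negPn/eqP lam_w := lam_eq w.
  by rewrite biadditiveDr lamD -{1}lam_w f_alternating -lamD addNr.
by exists u.
Qed.

Lemma weil_multiplicity_free (d : nat)
    (W : mx_representation F (unitary_group h) d) :
  weil f lambda W -> multiplicity_free_with W (2 * \sum_(i < m.+1) #|k| ^ i)%N.
Proof.
case=> S S_schrodinger W_S.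
have [lift [star_lift lift_surj lift_inj]] := residue_lift.
have piL1 : pi ^+ (2 * m).+1.-1 != 0 := pi_exp_neq0.
rewrite -(sum_card_pi_fixed star_involutive star_pi two_unit toA_nonunit
  star_congruent pi_exp piL1 star_lift lift_surj lift_inj);
  last by rewrite mulnS.
rewrite -(card_orbit_classes star_involutive star_pi two_unit toA_nonunit
  star_congruent pi_exp piL1 h_skew h_nondegenerate).
apply: (multiplicity_free_orbits (T := heis_op S)
  (to := fun g v => GLval g *m v) (psi := fun u v => lambda (f u v))).
- exact: heis_op_span S_schrodinger.
- exact: heis_op_free lambda_character S_schrodinger character_separates.
- exact: heis_opM S_schrodinger.
- by move=> g _; apply: (can_inj (mulKmx (GL_unitmx g))).
- move=> g v Gg; rewrite /heis_op -W_S // mulmxKV //.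
  exact: repr_mx_unit.
- exact: (orbit_classP star_involutive star_pi two_unit toA_nonunit
    star_congruent pi_exp piL1 h_skew h_nondegenerate).
move=> w; have [sigma sigma_inj sigmaP] := orbit_twist star_involutive star_pi
  two_unit toA_nonunit star_congruent pi_exp piL1 h_skew h_nondegenerate w.
exists sigma => // u; have [clu clwu hu] := sigmaP u; split=> //.
have fB x y z : f x (y - z) = f x y - f x z.
  by apply: (addIr (f x z)); rewrite -biadditiveDr !subrK.
(* As [f] is alternating, the two arguments of [lambda] reduce to [f (sigma u) w] and [f w u]. *)
congr (lambda _); rewrite [RHS]f_alternating !fB !f_diag !subr0.
rewrite -f_alternating; apply: iota_inj.
by rewrite !fE hu.
Qed.

End WeilRepresentation.
End Presentation.

Theorem theorem5p3
  (* the local principal ideal domain O and its residue field k *)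
  (O : idomainType) (s : O)
  (O_principal : all_ideals_principal O)
  (O_local : local_with_maximal_ideal (multiples s))
  (O_not_field : ~ GRing.field_axiom O)
  (k : finFieldType) (res : {rmorphism O -> k})
  (res_quotient : is_quotient res (multiples s))
  (k_odd : forall p, p \in [pchar k] -> odd p)
  (l : nat) (l_ge1 : (1 <= l)%N)
  (* R = O / (s^l) and A = (O[X] / (X^2 - s)) / (t^(2l - 1)) *)
  (R : finComUnitRingType) (toR : {rmorphism O -> R})
  (R_quotient : is_quotient toR (multiples (s ^+ l)))
  (A : finComUnitRingType)
  (toA : {rmorphism {poly %/ 'X^2 - s%:P} -> A})
  (A_quotient : is_quotient toA (multiples ('qX ^+ (2 * l - 1))))
  (* the embedding of R in A and the involution of A *)
  (iota : {rmorphism R -> A})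
  (iotaE : forall x, iota (toR x) = toA (qpolyC ('X^2 - s%:P) x))
  (star : {rmorphism A -> A})
  (star_iota : forall r, star (iota r) = iota r)
  (star_pi : star (toA 'qX) = - toA 'qX)
  (* the forms h and f *)
  (n : nat) (n_ge1 : (1 <= n)%N)
  (h : 'V_n[A] -> 'V_n[A] -> A)
  (h_skew : skew_hermitian star h)
  (h_nondegenerate : form_nondegenerate h)
  (f : biadditive 'V_n[A] R)
  (fE : forall v w, iota (f v w) = (h v w + star (h v w)) / 2%:R)
  (* the Weil representation, over the complex numbers K[i] *)
  (K : realType) (lambda : R -> K[i])
  (lambda_character : linear_character lambda)
  (lambda_primitive : primitive_character lambda)
  (d : nat) (W : mx_representation K[i] (unitary_group h) d)
  (W_weil : weil f lambda W) :
  multiplicity_free_with W (2 * \sum_(i < l) #|k| ^ i)%N.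
Proof.
(* Writing [l = m.+1] turns the truncated exponent [2 * l - 1] into [(2 * m).+1]. *)
case: l l_ge1 => // m _ in R_quotient A_quotient *.
have A_quotient' : is_quotient toA (multiples ('qX ^+ (2 * m).+1)).
  by move: A_quotient; rewrite mulnS.
apply: (@weil_multiplicity_free _ _ _ (qpolyC ('X^2 - s%:P)) 'qX _ _ _
  O_local O_not_field _ _ res_quotient k_odd m _ _ R_quotient _ _ A_quotient'
  _ iotaE _ star_iota star_pi _ _ h_skew h_nondegenerate _ fE _ _
  lambda_character lambda_primitive) => //.
- exact: qX_sqr.
- exact: quadratic_decomp.
- exact: quadratic_coef_inj.
Qed.
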